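(* Let $\alpha_0+\alpha_1+\alpha_2=\frac12$ and consider the system $$\frac{dx}{dt}=\frac{2x^2y}{t}-x^2-\frac{2\alpha_0x}{t}+\frac1t,\qquad \frac{dy}{dt}=-\frac{2xy^2}{t}+2xy+\frac{2\alpha_0y}{t}+\alpha_1.$$ Make the change of parameters and variables $$\alpha_0=\frac{\beta_2-\beta_0}{2},\quad\alpha_1=\beta_0,\quad\alpha_2=\beta_1,\qquad x=\frac1X,\quad y=-X(YX+\beta_0),\quad T=t$$ from $x,y,t,\alpha_0,\alpha_1,\alpha_2$ to $X,Y,T,\beta_0,\beta_1,\beta_2$. Then the new system coincides with the system of type $C_2^{(1)}$: $$\frac{dX}{dT}=\frac{2X^2Y}{T}-\frac{X^2}{T}+\frac{(\beta_0+\beta_2)X}{T}+1,\qquad \frac{dY}{dT}=-\frac{2XY^2}{T}+\frac{2XY}{T}-\frac{(\beta_0+\beta_2)Y}{T}+\frac{\beta_0}{T},$$ with the Hamiltonian $$H_{C_2^{(1)}}(X,Y,T;\beta_0,\beta_1,\beta_2)=\frac{X^2Y(Y-1)+X[(\beta_0+\beta_2)Y-\beta_0]+TY}{T}\qquad(\beta_0+2\beta_1+\beta_2=1).$$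
   Context: A Hamiltonian system with Hamiltonian $K(X,Y,T)$ means $dX/dT=\partial K/\partial Y$, $dY/dT=-\partial K/\partial X$. *)

(* Defs.v *)
From mathcomp Require Import all_boot all_order all_algebra ring.
From mathcomp Require Import all_classical all_reals all_analysis.
Set Implicit Arguments.
Unset Strict Implicit.
Unset Printing Implicit Defensive.
Import Order.TTheory GRing.Theory Num.Theory.
Import numFieldNormedType.Exports.
Local Open Scope classical_set_scope.
Local Open Scope ring_scope.

(* The ground field K is any numFieldType with its norm topology: it covers
   both the real numbers (K : realType) and the complex numbers
   (K = R[i] with R : realType), [is_derive] being the derivative with respect
   to the variable in K, i.e. the complex derivative in the latter case. *)

(* The planar non-autonomous system dq/dt = rhs1 q p t, dp/dt = rhs2 q p t. *)
Record system (K : numFieldType) := System {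
  rhs1 : K -> K -> K -> K;
  rhs2 : K -> K -> K -> K }.

Definition solution_on (K : numFieldType) (S : system K) (U : set K)
    (q p : K -> K) : Prop :=
  forall t : K, U t ->
    is_derive t 1 q (rhs1 S (q t) (p t) t) /\
    is_derive t 1 p (rhs2 S (q t) (p t) t).

(* The systems below have a pole at time 0, which is therefore excluded. *)
Definition has_hamiltonian (K : numFieldType) (S : system K)
    (H : K -> K -> K -> K) : Prop :=
  forall q p t : K, t != 0 ->
    is_derive p 1 (fun p' : K => H q p' t) (rhs1 S q p t) /\
    is_derive q 1 (fun q' : K => H q' p t) (- rhs2 S q p t).

Definition original_system (K : numFieldType) (alpha0 alpha1 : K) : system K :=
  System
    (fun x y t => 2 * x ^+ 2 * y / t - x ^+ 2 - 2 * alpha0 * x / t + 1 / t)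
    (fun x y t => - (2 * x * y ^+ 2 / t) + 2 * x * y + 2 * alpha0 * y / t
                  + alpha1).

Definition C2_system (K : numFieldType) (beta0 beta2 : K) : system K :=
  System
    (fun X Y T => 2 * X ^+ 2 * Y / T - X ^+ 2 / T + (beta0 + beta2) * X / T + 1)
    (fun X Y T => - (2 * X * Y ^+ 2 / T) + 2 * X * Y / T
                  - (beta0 + beta2) * Y / T + beta0 / T).

Definition C2_hamiltonian (K : numFieldType) (beta0 beta2 : K) (X Y T : K) : K :=
  (X ^+ 2 * Y * (Y - 1) + X * ((beta0 + beta2) * Y - beta0) + T * Y) / T.

(* The condition X != 0 makes x = 1 / X meaningful, division being total. *)
Definition variable_change (K : numFieldType) (beta0 : K)
    (x y t X Y T : K) : Prop :=
  [/\ X != 0, x = 1 / X, y = - X * (Y * X + beta0) & T = t].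

(* The change of variables is a bijection from {x <> 0} onto {X <> 0}. *)
Lemma variable_change_inv (K : numFieldType) (beta0 x y t X Y T : K) :
  variable_change beta0 x y t X Y T <->
  [/\ x != 0, X = 1 / x, Y = - x * (x * y + beta0) & T = t].
Proof.
by split=> -[nz -> -> ->]; split; rewrite ?mul1r ?invr_eq0 ?invrK //; field.
Qed.

(* Main.v *)
Require Import Defs.
From mathcomp Require Import all_boot all_order all_algebra ring.
From mathcomp Require Import all_classical all_reals all_analysis.
Import Order.TTheory GRing.Theory Num.Theory.
Import numFieldNormedType.Exports.
Local Open Scope classical_set_scope.
Local Open Scope ring_scope.

(* The change of variables has the shape (q, p) |-> (1 / q, - q (q p + b)), and
   so does its inverse, with the same b. Differentiating this one map therefore
   transports solutions both ways, and what remains is that it carries each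
   vector field to the other, an identity of rational functions wherever q and
   t do not vanish. *)

(* [is_deriveV] of the library requires a [realType]. *)
Lemma is_derive_inv (K : numFieldType) (f : K -> K) (t df : K) :
  f t != 0 -> is_derive t 1 f df ->
  is_derive t 1 (fun s => (f s)^-1) (- (df / f t ^+ 2)).
Proof.
move=> ft0 [fd fdE]; apply: DeriveDef; first exact: derivableV.
by rewrite deriveV // fdE /GRing.scale /= mulNr mulrC.
Qed.

(** The Hamiltonian has degree at most two in [X] and in [Y] separately, so this one formula yields
    both of its partial derivatives. *)
Lemma is_derive_quadratic (K : numFieldType) (a b c x : K) :
  is_derive x 1 (fun s => a * s ^+ 2 + b * s + c) (2 * a * x + b).
Proof.
have did := is_derive_id x (1 : K).
have dX := is_deriveX 2 did.
apply: is_derive_eq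
  (is_deriveD (is_deriveD (is_deriveM (is_derive_cst a x 1) dX)
                          (is_deriveM (is_derive_cst b x 1) did))
              (is_derive_cst c x 1)) _.
by rewrite /GRing.scale /= /cst; ring.
Qed.

Lemma is_derive_opp_mul_affine (K : numFieldType) (b : K) (q p : K -> K)
    (t dq dp : K) :
  is_derive t 1 q dq -> is_derive t 1 p dp ->
  is_derive t 1 (fun s => - q s * (q s * p s + b))
    (- (dq * (2 * (q t * p t) + b) + q t ^+ 2 * dp)).
Proof.
move=> qd pd.
apply: is_derive_eq
  (is_deriveM (is_deriveN qd)
              (is_deriveD (is_deriveM qd pd) (is_derive_cst b t 1))) _.
by rewrite /GRing.scale /= /cst !fctE; ring.
Qed.

(** Differentiating [1 / q] and [- q (q p + b)] along a solution of [S] gives exactly the right-hand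
    sides of the two field hypotheses, which thus say that the map pushes [S] forward to [S']. *)
Lemma solution_on_change (K : numFieldType) (S S' : system K) (U : set K)
    (b : K) (q p Q P : K -> K) :
  open U ->
  (forall t, U t ->
     [/\ q t != 0, Q t = 1 / q t & P t = - q t * (q t * p t + b)]) ->
  (forall t, U t ->
     rhs1 S' (Q t) (P t) t = - (rhs1 S (q t) (p t) t / q t ^+ 2)) ->
  (forall t, U t ->
     rhs2 S' (Q t) (P t) t =
     - (rhs1 S (q t) (p t) t * (2 * (q t * p t) + b)
        + q t ^+ 2 * rhs2 S (q t) (p t) t)) ->
  solution_on S U q p -> solution_on S' U Q P.
Proof.
move=> Uo ch E1 E2 sol t Ut; have [qd pd] := sol t Ut.
have [qt0 _ _] := ch t Ut.
(* A derivative at [t] depends on values near [t]: openness of [U] makes the formulas for [Q] and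
   [P] hold on a neighbourhood, not just at [t]. *)
have nU : \forall s \near t, U s by exact: open_nbhs_nbhs.
split; [rewrite E1 //|rewrite E2 //].
- apply: near_eq_is_derive (is_derive_inv _ _ _ _ qt0 qd).
  by apply: filterS nU => s /ch[_ -> _]; rewrite div1r.
- apply: near_eq_is_derive (is_derive_opp_mul_affine _ b _ _ _ _ _ qd pd).
  by apply: filterS nU => s /ch[_ _ ->].
Qed.

Lemma C2_system_hamiltonian (K : numFieldType) (beta0 beta2 : K) :
  has_hamiltonian (C2_system beta0 beta2) (C2_hamiltonian beta0 beta2).
Proof.
move=> q p t t0; split.
- rewrite (_ : (fun p' => _) = fun s => (q ^+ 2 / t) * s ^+ 2
      + ((- q ^+ 2 + q * (beta0 + beta2) + t) / t) * s + - (q * beta0 / t)).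
    by apply: is_derive_eq (is_derive_quadratic _ _ _ _ _) _; rewrite /=; field.
  by apply/funext => s; rewrite /C2_hamiltonian; field.
(* Collected by powers of [q]; the constant term [p] is [t * p / t], where [t != 0] enters. *)
- rewrite (_ : (fun q' => _) = fun s => (p * (p - 1) / t) * s ^+ 2
      + (((beta0 + beta2) * p - beta0) / t) * s + p).
    by apply: is_derive_eq (is_derive_quadratic _ _ _ _ _) _; rewrite /=; field.
  by apply/funext => s; rewrite /C2_hamiltonian; field.
Qed.

Theorem theorem3p5 (K : numFieldType)
    (alpha0 alpha1 alpha2 beta0 beta1 beta2 : K)
    (sum_alpha : alpha0 + alpha1 + alpha2 = 1 / 2)
    (change0 : alpha0 = (beta2 - beta0) / 2)
    (change1 : alpha1 = beta0)
    (change2 : alpha2 = beta1) :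
  [/\ beta0 + 2 * beta1 + beta2 = 1,
      forall (U : set K) (x y X Y : K -> K),
        open U -> ~ U 0 ->
        (forall t : K, U t ->
           variable_change beta0 (x t) (y t) t (X t) (Y t) t) ->
        (solution_on (original_system alpha0 alpha1) U x y <->
         solution_on (C2_system beta0 beta2) U X Y)
    & has_hamiltonian (C2_system beta0 beta2) (C2_hamiltonian beta0 beta2)].
Proof.
split; last exact: C2_system_hamiltonian.
(* The factor 2 clears the denominators in [sum_alpha] and [change0]. *)
- transitivity (2 * (alpha0 + alpha1 + alpha2)); last first.
    by rewrite sum_alpha; field.
  by rewrite change0 change1 change2; field.
move=> U x y X Y Uo U0 ch.
have nz t : U t -> t != 0 by move=> Ut; apply/eqP => t0; apply: U0; rewrite -t0.
split.
(* From [(x, y)] to [(X, Y)] the new variables must be expressed by the old ones, hence the inverse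
   formulas; the converse uses [ch] directly. *)
- have chV t (Ut : U t) := (variable_change_inv _ _ _ _ _ _ _).1 (ch t Ut).
  apply: (@solution_on_change _ _ _ _ beta0) => // t Ut;
    have [xt0 XE YE _] := chV t Ut; have t0 := nz t Ut.
  + by [].
  + by rewrite /= XE YE change0; field; apply/andP; split.
  + by rewrite /= XE YE change0 change1; field; apply/andP; split.
- apply: (@solution_on_change _ _ _ _ beta0) => // t Ut;
    have [Xt0 xE yE _] := ch t Ut; have t0 := nz t Ut.
  + by rewrite xE yE (mulrC (Y t)).
  + by rewrite /= xE yE change0; field; apply/andP; split.
  + by rewrite /= xE yE change0 change1; field; apply/andP; split.
Qed.
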